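(* Let $\mathcal{H}$ be a Hilbert space, let $C\in\mathcal{B}(\mathcal{H})$ be similar to a contraction, and let $E\in\mathcal{B}(\mathcal{H})$ have spectral radius $r(E)<1$ and satisfy $EC=0$. Then $T=C+E$ is similar to a contraction.
   Context: An operator $T$ is a zero-product perturbation of $C$ by $E$ if $T=C+E$ and $EC=0$. An operator $R\in\mathcal{B}(\mathcal{H})$ is similar to a contraction if there is an invertible $L\in\mathcal{B}(\mathcal{H})$ with $\|L^{-1}RL\|\le 1$. *)

(* Defs.v *)
(* Complex scalars are R[i] (mathcomp-real-closed)
   for an abstract R : realType. *)
From mathcomp Require Import all_boot all_algebra.
From mathcomp Require Import complex.
From mathcomp Require Import all_classical all_reals all_analysis.
Import GRing.Theory Num.Theory.
Local Open Scope ring_scope.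
Local Open Scope classical_set_scope.

Section HilbertOps.
Context {R : realType} {V : completeNormedModType R[i]}.

(* [ip] is an inner product on V inducing the norm of V; together with the
   completeness of V this says that V is a complex Hilbert space. *)
Definition is_inner_product (ip : V -> V -> R[i]) : Prop :=
  [/\ (forall (a : R[i]) (x y z : V), ip (a *: x + y) z = a * ip x z + ip y z),
      (forall x y : V, ip y x = (ip x y)^*) &
      (forall x : V, `|x| ^+ 2 = ip x x)].

(* a linear map V -> V is in B(H) iff it is bounded *)
Definition bounded_op (f : V -> V) : Prop :=
  exists M : R[i], forall x : V, `|f x| <= M * `|x|.

(* operator norm at most 1 *)
Definition is_contraction (f : V -> V) : Prop :=
  forall x : V, `|f x| <= `|x|.

(* invertible in B(H) *)
Definition invertible_op (f : V -> V) : Prop :=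
  exists g : {linear V -> V}, bounded_op g /\
    (forall x, f (g x) = x) /\ (forall x, g (f x) = x).

(* R similar to a contraction: exists invertible L in B(H), ||L^-1 R L|| <= 1 *)
Definition similar_to_contraction (T : {linear V -> V}) : Prop :=
  exists L Linv : {linear V -> V},
    [/\ bounded_op L, bounded_op Linv,
        (forall x, L (Linv x) = x), (forall x, Linv (L x) = x) &
        is_contraction (Linv \o T \o L)].

(* spectrum of f in B(H) *)
Definition spectrum (f : V -> V) : set R[i] :=
  [set l | ~ invertible_op (fun x => f x - l *: x)].

(* spectral radius: sup of the moduli of spectral values (the modulus of
   l : R[i] is the real number complex.Re `|l|) *)
Definition spectral_radius (f : V -> V) : R :=
  sup [set complex.Re `|l| | l in spectrum f].

End HilbertOps.

(* Main.v *)
From HB Require Import structures.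
Require Import Defs.
From mathcomp Require Import all_boot all_order all_algebra.
From mathcomp Require Import complex.
From mathcomp Require Import all_classical all_reals all_analysis.
From mathcomp Require Import ring lra.
Import GRing.Theory Num.Theory.
Import Order.TTheory numFieldNormedType.Exports.
Local Open Scope ring_scope.

(** Conjugating by the similarity, take [C] to be a contraction. Since
    [r(E) < 1], the powers of [E] decay geometrically, so [A = sum C*^n E^n]
    converges and satisfies [A = 1 + C* A E]. As [EC = 0], for [T = C + E] we have
    [A T = C + A E] and [E T = E^2]; together with [A x = x + C* A E x] this gives
    [|A T x|^2 <= |A x|^2 + |A E x|^2]. Hence [T] does not increase
    [Q x = |A x|^2 + w sum_(1 <= k <= N) |E^k x|^2] once [N] and [w] are large: the
    decay of the second term pays for [|A E x|^2]. The form [Q] is equivalent to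
    the norm squared, so [Q x = d |S x|^2] with [S] an invertible square root of
    its Gram operator, and [S T S^-1] is a contraction. *)

(** * The norm as a real number *)

Section RealNorm.
Local Open Scope complex_scope.
Context {R : realType} {V : completeNormedModType R[i]}.
Implicit Types (x y z : V) (a : R[i]) (r K q : R).

(** Norms and moduli take values in [R[i]], whose order is only partial. Their real parts carry the
    same information and live in [R], where [lra] applies. *)
Definition cabs a : R := complex.Re `|a|.
Definition nrm x : R := complex.Re `|x|.

Lemma ge0_ReE (a : R[i]) : 0 <= a -> a = (complex.Re a)%:C.
Proof. by case: a => r s; rewrite lecE /= => /andP[/eqP -> _]. Qed.

Lemma normE x : `|x| = (nrm x)%:C.
Proof. exact: ge0_ReE. Qed.

Lemma cabsE a : `|a| = (cabs a)%:C.
Proof. exact: ge0_ReE. Qed.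

Lemma nrm_ge0 x : 0 <= nrm x.
Proof. by rewrite -(@lecR R) -normE; exact: normr_ge0. Qed.

Lemma cabs_ge0 a : 0 <= cabs a.
Proof. by rewrite -(@lecR R) -cabsE; exact: normr_ge0. Qed.

Lemma nrmD x y : nrm (x + y) <= nrm x + nrm y.
Proof. by rewrite -(@lecR R) rmorphD /= -!normE ler_normD. Qed.

Lemma nrmN x : nrm (- x) = nrm x.
Proof. by rewrite /nrm normrN. Qed.

Lemma nrmZ a x : nrm (a *: x) = cabs a * nrm x.
Proof.
by apply: (@complexI R); rewrite rmorphM /= -normE -normE -cabsE normrZ.
Qed.

Lemma cabsR r : cabs r%:C = `|r|.
Proof. by rewrite /cabs normc_def /= expr0n addr0 sqrtr_sqr. Qed.

Lemma nrmZr r x : nrm (r%:C *: x) = `|r| * nrm x.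
Proof. by rewrite nrmZ cabsR. Qed.

Lemma cabsM a b : cabs (a * b) = cabs a * cabs b.
Proof. by apply: (@complexI R); rewrite rmorphM /= -!cabsE normrM. Qed.

Lemma cabsN a : cabs (- a) = cabs a.
Proof. by rewrite /cabs normrN. Qed.

Lemma nrm0 : nrm 0 = 0.
Proof. by rewrite /nrm normr0. Qed.

Lemma nrm0_eq0 x : nrm x = 0 -> x = 0.
Proof. by move=> x0; apply: normr0_eq0; rewrite normE x0. Qed.

Lemma nrmBC x y : nrm (x - y) = nrm (y - x).
Proof. by rewrite -nrmN opprB. Qed.

Lemma nrm_triangle y x z : nrm (x - z) <= nrm (x - y) + nrm (y - z).
Proof. by rewrite (le_trans _ (nrmD _ _))// addrA subrK. Qed.

(** * Limits with a geometric rate *)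

Lemma geometric_small K q (e : R) :
  0 <= q < 1 -> 0 < e -> exists n, K * q ^+ n <= e.
Proof.
move=> /andP[q0 q1] e0.
have : (geometric K q x @[x --> \oo] --> 0)%classic.
  by apply: cvg_geometric; rewrite ger0_norm.
move=> /cvgrPdist_lt /(_ e e0) [n _ /(_ n (leqnn n))] /=.
by rewrite sub0r normrN => /ltW /(le_trans (ler_norm _)) ?; exists n.
Qed.

Lemma le0_geometric K q (r : R) :
  0 <= q < 1 -> (forall n, r <= K * q ^+ n) -> r <= 0.
Proof.
move=> q01 rK; rewrite leNgt; apply/negP => r0.
have [n Kn] := @geometric_small K q (r / 2) q01 ltac:(lra).
by have := rK n; lra.
Qed.

Lemma cvg_geometric_steps (u : nat -> V) K q : 0 <= q < 1 ->
  (forall n, nrm (u n.+1 - u n) <= K * q ^+ n) ->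
  exists l, forall n, nrm (u n - l) <= K / (1 - q) * q ^+ n.
Proof.
move=> q01; have [q0 q1] := andP q01 => uK.
have K0 : 0 <= K by have := uK 0; rewrite expr0 mulr1; apply: le_trans (nrm_ge0 _).
set M := K / (1 - q).
have M0 : 0 <= M by rewrite divr_ge0// subr_ge0 ltW.
have MK : M * (1 - q) = K by rewrite /M divfK// gt_eqF// subr_gt0.
(* The bound is the exact geometric sum, which lets the induction on [k] close; the subtracted term
   is dropped only afterwards. *)
have umn n k : nrm (u (n + k)%N - u n) <= M * (q ^+ n - q ^+ (n + k)).
  elim: k => [|k IH]; first by rewrite addn0 !subrr mulr0 nrm0.
  rewrite addnS; apply: le_trans (nrm_triangle (u (n + k)%N) _ _) _.
  have := uK (n + k)%N; rewrite -MK exprS; lra.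
have umn' n k : nrm (u (n + k)%N - u n) <= M * q ^+ n.
  apply: le_trans (umn n k) _; rewrite ler_wpM2l// gerBl exprn_ge0//.
have ucvg : (cvg (u @ \oo))%classic.
  apply: cauchy_cvg; apply: cauchy_exP => e e0.
  have e0' : 0 < complex.Re e by move: e0; rewrite ltcE => /andP[].
  have [n Mn] := @geometric_small M q (complex.Re e / 2) q01 ltac:(lra).
  exists (u n), n => // m /= nm.
  rewrite -ball_normE /= (ge0_ReE _ (ltW e0)) normE ltcR nrmBC.
  by rewrite -(subnKC nm); apply: le_lt_trans (umn' _ _) _; lra.
case/cvg_ex: ucvg => l /cvgrPdist_lt ul; exists l => n.
apply/ler_addgt0Pr => e e0.
have [m _ /(_ (maxn m n) (leq_maxl _ _)) /=] := ul e%:C ltac:(by rewrite ltcR).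
have nm : (n <= maxn m n)%N by rewrite leq_maxr.
rewrite normE ltcR => h.
apply: le_trans (nrm_triangle (u (maxn m n)) _ _) _.
apply: lerD; last by rewrite nrmBC ltW.
by rewrite -(subnKC nm) nrmBC.
Qed.

Lemma nrm_small_eq0 x K q :
  0 <= q < 1 -> (forall n, nrm x <= K * q ^+ n) -> x = 0.
Proof.
move=> q01 h; apply: nrm0_eq0; apply/eqP; rewrite eq_le nrm_ge0 andbT.
exact: le0_geometric h.
Qed.

(** * Bounded operators and their pointwise limits *)

Definition bounded_by K (f : V -> V) := forall x, nrm (f x) <= K * nrm x.

Lemma bounded_opP (f : V -> V) :
  bounded_op f <-> exists2 K, 0 <= K & bounded_by K f.
Proof.
split=> [[M fM]|[K K0 fK]]; last first.
  by exists K%:C => x; rewrite !normE -rmorphM lecR.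
(* [M] is an arbitrary complex number, and its real part can be negative when [V] is trivial; hence
   the absolute value. *)
exists `|complex.Re M| => // x.
have := fM x; rewrite !normE lecE; case: M {fM} => s t /= => /andP[_].
rewrite mulr0 subr0 => /le_trans; apply.
by rewrite ler_wpM2r ?nrm_ge0// ler_norm.
Qed.

(** Operators arise below as bare functions, from pointwise choices, iterations and formulas; this
    packs them as [{linear V -> V}]. *)
Lemma linear_of (f : V -> V) :
  (forall a x y, f (a *: x + y) = a *: f x + f y) ->
  exists F : {linear V -> V}, F =1 f.
Proof.
move=> fl.
by exists (HB.pack_for {linear V -> V} f (GRing.isLinear.Build R[i] V V *:%R f fl)).
Qed.

(** Completeness gives a limit at each point. The limit is linear because its linearity defect is at
    most a fixed multiple of [q ^+ n] for every [n]. *)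
Lemma linear_cvg_geometric (U : nat -> {linear V -> V}) K q : 0 <= q < 1 ->
  (forall n x, nrm (U n.+1 x - U n x) <= K * q ^+ n * nrm x) ->
  exists L : {linear V -> V},
    forall n x, nrm (U n x - L x) <= K / (1 - q) * q ^+ n * nrm x.
Proof.
move=> q01 UK.
have /choice [f fU] :
  forall x, exists l, forall n, nrm (U n x - l) <= K / (1 - q) * q ^+ n * nrm x.
  move=> x; have [n|l lU] := @cvg_geometric_steps (U ^~ x) (K * nrm x) q q01.
    by rewrite mulrAC; exact: UK.
  by exists l => n; rewrite [leRHS](_ : _ = K * nrm x / (1 - q) * q ^+ n) //; ring.
have [a x y|F Ff] := linear_of f; last by exists F => n x; rewrite Ff.
apply/eqP; rewrite -subr_eq0; apply/eqP.
set M := K / (1 - q) in fU.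
apply: (@nrm_small_eq0 _ (M * (nrm (a *: x + y) + (cabs a * nrm x + nrm y))) q) => // n.
have -> : f (a *: x + y) - (a *: f x + f y) =
   - (U n (a *: x + y) - f (a *: x + y)) + (a *: (U n x - f x) + (U n y - f y)).
  by rewrite scalerBr addrACA -opprD -linearP opprB addrA subrK.
apply: le_trans (nrmD _ _) _; rewrite nrmN.
have := nrmD (a *: (U n x - f x)) (U n y - f y); rewrite nrmZ.
have := ler_wpM2l (cabs_ge0 a) (fU x n); have := fU y n.
have := fU (a *: x + y) n; lra.
Qed.

(** * Neumann series *)

Lemma neumann_lower (F : {linear V -> V}) q x :
  bounded_by q F -> (1 - q) * nrm x <= nrm (x - F x).
Proof.
move=> Fq; have := nrmD (x - F x) (F x); rewrite subrK.
by have := Fq x; lra.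
Qed.

(** [G] is the limit of the partial sums [U n] of the powers of [F]. The recursion
    [U (n+1) = 1 + F U n] gives the right inverse in the limit; [neumann_lower] gives the norm bound
    and, through injectivity of [1 - F], the left inverse. *)
Lemma neumann (F : {linear V -> V}) q : 0 <= q < 1 -> bounded_by q F ->
  exists G : {linear V -> V}, [/\ bounded_by (1 - q)^-1 G,
    forall x, G x - F (G x) = x & forall x, G (x - F x) = x].
Proof.
move=> q01 Fq; have [q0 q1] := andP q01.
have /choice[U Ueq] : forall n, exists u : {linear V -> V},
    u =1 fun x => iter n (fun y => x + F y) x.
  move=> n; apply: linear_of; elim: n => [//|n IH] a x y /=.
  by rewrite IH linearP scalerDr addrACA.
have U0 x : U 0%N x = x by exact: (Ueq 0%N).
have US n x : U n.+1 x = x + F (U n x) by rewrite (Ueq n.+1) (Ueq n).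
have US' n x : U n.+1 x = U n x + iter n.+1 F x.
  elim: n x => [|n IH] x; first by rewrite US U0.
  by rewrite US {1}IH linearD /= addrA -US.
have Fn n x : nrm (iter n F x) <= q ^+ n * nrm x.
  elim: n => [|n IH] /=; first by rewrite expr0 mul1r.
  by rewrite exprS -mulrA; apply: le_trans (Fq _) _; rewrite ler_wpM2l.
have [|G GU] := @linear_cvg_geometric U q q q01.
  by move=> n x; rewrite US' addrC addKr -exprS; exact: Fn.
have M0 : 0 <= q / (1 - q) by rewrite divr_ge0// subr_ge0 ltW.
have GF x : G x - F (G x) = x.
  apply/eqP; rewrite -subr_eq0; apply/eqP.
  apply: (@nrm_small_eq0 _ (2 * (q / (1 - q)) * nrm x) q) => // n.
  have -> : G x - F (G x) - x = (G x - U n.+1 x) + F (U n x - G x).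
    by rewrite US linearB /= opprD !addrA subrK addrAC.
  have := nrmD (G x - U n.+1 x) (F (U n x - G x)); rewrite (nrmBC (G x)).
  have := GU n.+1 x; have := GU n x; have := Fq (U n x - G x).
  have MM : 0 <= q / (1 - q) * (q ^+ n * nrm x).
    by rewrite mulr_ge0// mulr_ge0 ?exprn_ge0 ?nrm_ge0.
  have qM : q * (q / (1 - q) * (q ^+ n * nrm x)) <= q / (1 - q) * (q ^+ n * nrm x).
    by rewrite ler_piMl// ltW.
  have qn := nrm_ge0 (U n x - G x).
  have qq : q * nrm (U n x - G x) <= nrm (U n x - G x) by rewrite ler_piMl// ltW.
  by rewrite exprS; lra.
exists G; split=> // x.
  rewrite ler_pdivlMl ?subr_gt0//; apply: le_trans (neumann_lower F q (G x) Fq) _.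
  by rewrite GF.
have := GF (x - F x); move: (G _) => g gF.
apply/eqP; rewrite -subr_eq0; apply/eqP; apply: nrm0_eq0.
have := neumann_lower F q (g - x) Fq.
rewrite linearB opprD opprK addrACA gF -[- x + F x]opprK opprD opprK subrr nrm0.
by rewrite pmulr_rle0 ?subr_gt0// => h; apply/eqP; rewrite eq_le h nrm_ge0.
Qed.
End RealNorm.

(** * The real inner product *)

Section CauchySchwarz.
Local Open Scope complex_scope.

(** Stated for a semi-definite real form, so as to serve both the inner product and the form
    [rip x (B y)] of a positive operator [B]. *)
Lemma cauchy_schwarz_form (R : realType) (V : lmodType R[i]) (b : V -> V -> R) :
  (forall x y z, b (x + y) z = b x z + b y z) ->
  (forall r x y, b (r%:C *: x) y = r * b x y) ->
  (forall x y, b x y = b y x) -> (forall x, 0 <= b x x) ->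
  forall x y, b x y ^+ 2 <= b x x * b y y.
Proof.
move=> bD bZ bC b0 x y.
have quad (s t : R) : 0 <= s ^+ 2 * b x x + 2 * s * t * b x y + t ^+ 2 * b y y.
  have := b0 (s%:C *: x + t%:C *: y).
  rewrite bD !bZ !(bC _ (_ + _)) !bD !bZ (bC y x) => /le_trans; apply.
  by rewrite le_eqVlt; apply/orP; left; apply/eqP; ring.
have [y0|y0] := eqVneq (b y y) 0; last first.
  have ygt0 : 0 < b y y by rewrite lt_def y0 b0.
  have := quad (b y y) (- b x y).
  have -> : b y y ^+ 2 * b x x + 2 * b y y * - b x y * b x y + (- b x y) ^+ 2 * b y y
    = b y y * (b x x * b y y - b x y ^+ 2) by ring.
  by rewrite pmulr_rge0// subr_ge0.
rewrite y0 mulr0.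
(* Here [b y y = 0], so the quadratic is affine in [t], and this choice of [s] and [t] forces
   [b x y = 0]. *)
have := quad (b x y) (- (b x x + 1)); rewrite y0 mulr0 addr0.
have -> : b x y ^+ 2 * b x x + 2 * b x y * - (b x x + 1) * b x y
  = - (b x x + 2) * b x y ^+ 2 by ring.
by rewrite mulNr oppr_ge0 pmulr_rle0//; have := b0 x; lra.
Qed.

End CauchySchwarz.

Section RealInnerProduct.
Local Open Scope complex_scope.
Context {R : realType} {V : completeNormedModType R[i]}.
Context (ip : V -> V -> R[i]) (Hip : is_inner_product ip).
Implicit Types (x y z : V) (a : R[i]) (r s K q : R).

Definition rip x y : R := complex.Re (ip x y).

Lemma ripDl x y z : rip (x + y) z = rip x z + rip y z.
Proof. by case: Hip => ipl _ _; rewrite /rip -{1}(scale1r x) ipl mul1r raddfD. Qed.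

Lemma ipZl a x y : ip (a *: x) y = a * ip x y.
Proof.
case: Hip => ipl _ _.
have ip0 z : ip 0 z = 0.
  by have := ipl (-1) z z z; rewrite scaleN1r addNr mulN1r addNr.
by rewrite -[a *: x]addr0 ipl ip0 addr0.
Qed.

Lemma ripC x y : rip x y = rip y x.
Proof. by case: Hip => _ ipC _; rewrite /rip ipC; case: (ip y x). Qed.

Lemma ripZl r x y : rip (r%:C *: x) y = r * rip x y.
Proof. by rewrite /rip ipZl; case: (ip x y) => u v /=; rewrite mul0r subr0. Qed.

(** This keeps track of sesquilinearity although only real parts are retained; it is what makes the
    operators built from forms complex linear. *)
Lemma ripZ a x y : rip x (a *: y) = rip (a^* *: x) y.
Proof.
case: Hip => _ ipC _; rewrite /rip (ipC (a *: y)) !ipZl (ipC x y).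
by case: a (ip x y) => u v [w t] /=; ring.
Qed.

Lemma rip_nrm x : rip x x = nrm x ^+ 2.
Proof.
by case: Hip => _ _ ipn; rewrite /rip -ipn normE -rmorphXn.
Qed.

Lemma ripDr x y z : rip z (x + y) = rip z x + rip z y.
Proof. by rewrite ripC ripDl !(ripC z). Qed.

Lemma ripZr r x y : rip x (r%:C *: y) = r * rip x y.
Proof. by rewrite ripC ripZl ripC. Qed.

Lemma ripNr x y : rip x (- y) = - rip x y.
Proof.
have -> : - y = (-1)%:C *: y by rewrite rmorphN rmorph1 scaleN1r.
by rewrite ripZr mulN1r.
Qed.

Lemma ripNl x y : rip (- x) y = - rip x y.
Proof. by rewrite ripC ripNr ripC. Qed.

Lemma ripBr x y z : rip z (x - y) = rip z x - rip z y.
Proof. by rewrite ripDr ripNr. Qed.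

Lemma ripBl x y z : rip (x - y) z = rip x z - rip y z.
Proof. by rewrite ripDl ripNl. Qed.

Lemma nrmD_sqr x y : nrm (x + y) ^+ 2 = nrm x ^+ 2 + 2 * rip x y + nrm y ^+ 2.
Proof. by rewrite -!rip_nrm ripDl !ripDr (ripC y x); ring. Qed.

Lemma rip_le x y : `|rip x y| <= nrm x * nrm y.
Proof.
rewrite -[leRHS]ger0_norm ?mulr_ge0 ?nrm_ge0// -ler_sqr ?nnegrE ?normr_ge0//.
rewrite !real_normK ?num_real// exprMn -!rip_nrm.
apply: cauchy_schwarz_form => [x1 y1 z||x1 y1|x1].
- exact: ripDl.
- exact: ripZl.
- exact: ripC.
- by rewrite rip_nrm sqr_ge0.
Qed.

Lemma rip_inj x y : (forall z, rip z x = rip z y) -> x = y.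
Proof.
move=> xy; apply/eqP; rewrite -subr_eq0; apply/eqP/nrm0_eq0/eqP.
by rewrite -sqrf_eq0 -rip_nrm ripBr xy subrr.
Qed.

(* A minimising sequence of [|x|^2 - 2 f x] converges, by the parallelogram
   identity, to the representing vector. *)
Lemma riesz (f : V -> R) K :
  (forall x y, f (x + y) = f x + f y) -> (forall r x, f (r%:C *: x) = r * f x) ->
  (forall x, `|f x| <= K * nrm x) -> exists z, forall x, f x = rip x z.
Proof.
move=> fD fZ fK; pose J x := nrm x ^+ 2 - 2 * f x.
have JD x y : J (x + y) = J x + 2 * (rip x y - f y) + nrm y ^+ 2.
  by rewrite /J nrmD_sqr fD; ring.
have [m mJ Jm] : exists2 m, (forall x, m <= J x) &
    forall e, 0 < e -> exists x, J x < m + e.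
  have Jlb : lbound (range J) (- K ^+ 2).
    move=> _ [x _ <-]; rewrite /J; have := fK x; have := ler_norm (f x).
    have := sqr_ge0 (nrm x - K); lra.
  have Jinf : has_inf (range J) by split; [exists (J 0), 0|exists (- K ^+ 2)].
  exists (inf (range J)) => [x|e e0].
    by apply: ge_inf; [exists (- K ^+ 2)|exists x].
  by have [_ [x _ <-] Jx] := inf_adherent e0 Jinf; exists x.
have /choice[u uJ] : forall n, exists x, J x < m + (2^-1 ^+ n) ^+ 2.
  by move=> n; apply: Jm; rewrite exprn_gt0// exprn_gt0// invr_gt0.
have half01 : 0 <= (2^-1 : R) < 1 by lra.
have [n|z zu] := @cvg_geometric_steps _ _ u 2 2^-1 half01.
  have q0 : 0 <= 2^-1 ^+ n :> R by rewrite exprn_ge0//; lra.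
  rewrite -ler_sqr ?nnegrE ?nrm_ge0 ?mulr_ge0//.
  set d := u n.+1 - u n.
  have e1 : u n.+1 = u n + d by rewrite addrC subrK.
  (* [J] is at least [m] at the midpoint of [u n] and [u n.+1], while both ends are nearly minimal;
     the parallelogram identity then bounds [d]. *)
  have := mJ (u n + 2^-1%:C *: d); rewrite JD ripZr fZ nrmZr exprMn.
  rewrite real_normK ?num_real//.
  have := uJ n.+1; rewrite e1 JD (exprS _ n).
  have := uJ n; have := sqr_ge0 (2^-1 ^+ n : R); move: (_ ^+ n) q0 => q q0; lra.
exists z => x; set g := rip x z - f x.
(* First variation: [J (u n + s x) >= m] for all [n], and letting [n] grow replaces [u n] by its
   limit [z]. *)
have gs s : 0 <= 2 * s * g + s ^+ 2 * nrm x ^+ 2.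
  rewrite -oppr_le0.
  apply: (@le0_geometric R (1 + 2 * `|s| * (nrm x * (2 / (1 - 2^-1)))) 2^-1) => // n.
  have q0 : 0 <= 2^-1 ^+ n :> R by rewrite exprn_ge0//; lra.
  have q1 : 2^-1 ^+ n <= 1 :> R by rewrite exprn_ile1//; lra.
  have q2 : (2^-1 ^+ n) ^+ 2 <= 2^-1 ^+ n :> R by rewrite expr2 ler_piMl.
  have := mJ (u n + s%:C *: x); rewrite JD ripZr fZ nrmZr exprMn real_normK ?num_real//.
  have := uJ n; have := ler_wpM2l (nrm_ge0 x) (zu n).
  have : 2 * s * rip (u n - z) x <= 2 * `|s| * (nrm x * nrm (u n - z)).
    rewrite -!mulrA ler_wpM2l//; apply: le_trans (ler_norm _) _.
    by rewrite normrM ler_wpM2l// mulrC rip_le.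
  rewrite ripBl (ripC z) -/g => h1 /(ler_wpM2l (normr_ge0 s)).
  by rewrite /g; lra.
have N0 : 0 < nrm x ^+ 2 + 1 by have := sqr_ge0 (nrm x); lra.
(* Near the minimiser in [s]; the added 1 keeps the denominator positive when [x = 0]. *)
have := gs (- g / (nrm x ^+ 2 + 1)).
have -> : 2 * (- g / (nrm x ^+ 2 + 1)) * g + (- g / (nrm x ^+ 2 + 1)) ^+ 2 * nrm x ^+ 2
  = - (g ^+ 2) * ((nrm x ^+ 2 + 2) / (nrm x ^+ 2 + 1) ^+ 2).
  by field; rewrite gt_eqF.
rewrite pmulr_lge0 ?divr_gt0 ?exprn_gt0//; last by lra.
rewrite oppr_ge0 => g2; have : g == 0 by rewrite -sqrf_eq0 eq_le g2 sqr_ge0.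
by rewrite subr_eq0 => /eqP.
Qed.

(** The Riesz theorem represents [b^~ y] by a vector [G y], and the rule for complex scalars makes
    [G] linear. Testing the form at [x = G y] bounds [G]. *)
Lemma form_operator (b : V -> V -> R) K :
  (forall x y z, b (x + y) z = b x z + b y z) ->
  (forall r x y, b (r%:C *: x) y = r * b x y) ->
  (forall x y z, b z (x + y) = b z x + b z y) ->
  (forall a x y, b x (a *: y) = b (a^* *: x) y) ->
  0 <= K -> (forall x y, `|b x y| <= K * nrm x * nrm y) ->
  exists2 G : {linear V -> V}, bounded_by K G & forall x y, b x y = rip x (G y).
Proof.
move=> bDl bZl bDr bZ K0 bK.
have /choice[g bg] : forall y, exists z, forall x, b x y = rip x z.
  move=> y; apply: (@riesz (b^~ y) (K * nrm y)) => // x.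
  by rewrite mulrAC.
have [a x y|G Gg] := linear_of g.
  by apply: rip_inj => z; rewrite -bg ripDr ripZ -!bg bDr bZ.
exists G => [y|x y]; last by rewrite Gg.
have := bK (G y) y; rewrite bg -Gg rip_nrm => /(le_trans (ler_norm _)).
have := nrm_ge0 (G y); rewrite le_eqVlt => /orP[/eqP <- _|Gy].
  by rewrite mulr_ge0 ?nrm_ge0.
by rewrite expr2 -mulrA mulrCA ler_pM2l.
Qed.

Lemma adjoint_exists (T : {linear V -> V}) K : 0 <= K -> bounded_by K T ->
  exists2 S : {linear V -> V}, bounded_by K S & forall x y, rip (T x) y = rip x (S y).
Proof.
move=> K0 TK; apply: form_operator => // [x y z|r x y|x y z|a x y|x y].
- by rewrite linearD ripDl.
- by rewrite linearZ ripZl.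
- by rewrite ripDr.
- by rewrite ripZ linearZ.
- by apply: le_trans (rip_le _ _) _; rewrite ler_wpM2r ?nrm_ge0.
Qed.
End RealInnerProduct.

(** * Square roots *)

Section SquareRoot.
Local Open Scope complex_scope.
Context {R : realType} {V : completeNormedModType R[i]}.
Context (ip : V -> V -> R[i]) (Hip : is_inner_product ip).
Implicit Types (x y z : V) (c d b q : R).
Let rip := rip ip.

(** Cauchy-Schwarz for the form [rip x (B y)], taken at [B y] and [y], bounds [|B y|^4] by
    [b |B y|^2] times [b |y|^2]. *)
Lemma symmetric_bounded_by (B : {linear V -> V}) b : 0 <= b ->
  (forall x y, rip x (B y) = rip (B x) y) ->
  (forall x, 0 <= rip x (B x) <= b * nrm x ^+ 2) -> bounded_by b B.
Proof.
move=> b0 Bsym Bb y.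
have CS := @cauchy_schwarz_form R V (fun x y => rip x (B y)).
have {}CS := CS (fun x y z => ripDl ip Hip x y (B z))
  (fun r x y => ripZl ip Hip r x (B y)).
have {}CS := CS (fun x y => etrans (Bsym x y) (ripC ip Hip _ _))
  (fun x => proj1 (andP (Bb x))).
have [->|By] := eqVneq (B y) 0; first by rewrite nrm0 mulr_ge0 ?nrm_ge0.
have ny : 0 < nrm (B y).
  by rewrite lt_def nrm_ge0 andbT; apply/eqP => /nrm0_eq0/eqP; apply/negP.
have := CS (B y) y; rewrite /rip (rip_nrm ip Hip) => h.
have [_ h1] := andP (Bb (B y)); have [h0 h2] := andP (Bb y).
have : (nrm (B y) ^+ 2) ^+ 2 <= (b * nrm (B y) ^+ 2) * (b * nrm y ^+ 2).
  by apply: le_trans h _; apply: ler_pM => //; case/andP: (Bb (B y)).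
have -> : b * nrm (B y) ^+ 2 * (b * nrm y ^+ 2) =
  nrm (B y) ^+ 2 * (b * nrm y) ^+ 2 by ring.
by rewrite expr2 ler_pM2l ?exprn_gt0// ler_sqr ?nnegrE ?mulr_ge0 ?nrm_ge0.
Qed.

(* [1 - Y] is the square root of [1 - B]; [Y] is the limit of the iterates of
   [Y |-> (B + Y^2) / 2]. *)
Lemma one_minus_sqrt (B : {linear V -> V}) b : 0 <= b < 1 ->
  (forall x y, rip x (B y) = rip (B x) y) -> bounded_by b B ->
  exists Y : {linear V -> V}, [/\ bounded_by b Y,
    forall x y, rip x (Y y) = rip (Y x) y &
    forall x, Y x = 2^-1%:C *: (B x + Y (Y x))].
Proof.
move=> b01 Bsym Bb; have [b0 b1] := andP b01.
have h2 : `|2^-1| = 2^-1 :> R by rewrite ger0_norm.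
have /choice[step stepE] : forall Y : {linear V -> V}, exists Y' : {linear V -> V},
    Y' =1 fun x => 2^-1%:C *: (B x + Y (Y x)).
  move=> Y; apply: linear_of => a x y.
  by rewrite !linearP addrACA -scalerDr [LHS]scalerDr !scalerA (mulrC a).
have [Z Z0] := @linear_of R V (fun=> 0) (fun a x y => ltac:(by rewrite scaler0 addr0)).
pose Y n := iter n step Z.
have YS n x : Y n.+1 x = 2^-1%:C *: (B x + Y n (Y n x)) by rewrite /Y /= stepE.
have Yb n : bounded_by b (Y n).
  elim: n => [|n IH] x; first by rewrite /Y /= Z0 nrm0 mulr_ge0 ?nrm_ge0.
  rewrite YS nrmZr h2; have := nrmD (B x) (Y n (Y n x)); have := Bb x.
  have := IH (Y n x); have := ler_wpM2l b0 (IH x).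
  have := ler_piMl (mulr_ge0 b0 (nrm_ge0 x)) (ltW b1).
  lra.
have Ysym n x y : rip x (Y n y) = rip (Y n x) y.
  elim: n x y => [|n IH] x y.
    by rewrite /Y /= !Z0 -(subrr 0) /rip ripBr// ripBl// !subrr.
  rewrite !YS /rip ripZr// ripZl// ripDr// ripDl//.
  by congr (_ * (_ + _)); [exact: Bsym|rewrite -!/(rip _ _) !IH].
have Ystep n x : nrm (Y n.+1 x - Y n x) <= b * b ^+ n * nrm x.
  elim: n x => [|n IH] x.
    rewrite YS /Y /= !Z0 addr0 subr0 expr0 mulr1 nrmZr h2; have := Bb x.
    have := mulr_ge0 b0 (nrm_ge0 x); lra.
  (* A difference of squares [P^2 - Q^2] is split as [P (P - Q) + (P - Q) Q], which avoids any
     commutation. *)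
  have -> : Y n.+2 x - Y n.+1 x =
     2^-1%:C *: (Y n.+1 (Y n.+1 x - Y n x) + (Y n.+1 (Y n x) - Y n (Y n x))).
    rewrite (YS n.+1 x) {2}(YS n x) -scalerBr [Y n.+1 (_ - _)]linearB.
    by rewrite addrA subrK opprD addrACA subrr add0r.
  rewrite nrmZr h2.
  have := nrmD (Y n.+1 (Y n.+1 x - Y n x)) (Y n.+1 (Y n x) - Y n (Y n x)).
  have := Yb n.+1 (Y n.+1 x - Y n x); have := ler_wpM2l b0 (IH x).
  have := IH (Y n x).
  have : b * b ^+ n * nrm (Y n x) <= b * b ^+ n * (b * nrm x).
    by rewrite ler_wpM2l ?Yb// mulr_ge0 ?exprn_ge0.
  by rewrite exprS; lra.
have [L YL] := linear_cvg_geometric Y b b b01 Ystep.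
set M := b / (1 - b) in YL.
have M0 : 0 <= M by rewrite divr_ge0// subr_ge0 ltW.
have Lb : bounded_by b L.
  move=> x; rewrite -subr_le0.
  apply: (@le0_geometric R (M * nrm x) b) => // n.
  have := nrm_triangle (Y n x) (L x) 0; rewrite !subr0 (nrmBC (L x)).
  by have := YL n x; have := Yb n x; lra.
exists L; split=> // [x y|x].
  apply/eqP; rewrite -subr_eq0 -normr_le0; apply/eqP.
  apply/eqP; apply: (@le0_geometric R (2 * M * (nrm x * nrm y)) b) => // n.
  have -> : rip x (L y) - rip (L x) y = rip (Y n x - L x) y - rip x (Y n y - L y).
    by rewrite /rip ripBl// ripBr// -/(rip _ _) -/rip Ysym; ring.
  apply: le_trans (ler_normB _ _) _.
  have := rip_le ip Hip (Y n x - L x) y; have := rip_le ip Hip x (Y n y - L y).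
  have := ler_wpM2l (nrm_ge0 x) (YL n y); have := ler_wpM2r (nrm_ge0 y) (YL n x).
  by rewrite /rip; lra.
apply/eqP; rewrite -subr_eq0; apply/eqP.
apply: (@nrm_small_eq0 _ _ _ (2 * M * nrm x) b) => // n.
have -> : L x - 2^-1%:C *: (B x + L (L x)) =
    (L x - Y n.+1 x) + 2^-1%:C *: (Y n (Y n x - L x) + (Y n (L x) - L (L x))).
  rewrite YS [Y n (_ - _)]linearB addrA subrK -addrA -!scalerN -scalerDr.
  by rewrite !opprD -addrA addKr.
apply: le_trans (nrmD _ _) _; rewrite nrmZr h2 (nrmBC (L x)).
have := nrmD (Y n (Y n x - L x)) (Y n (L x) - L (L x)).
have := YL n (L x); have := YL n.+1 x; have := Yb n (Y n x - L x).
have := ler_wpM2l b0 (YL n x).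
have M1 : 0 <= M * b ^+ n by rewrite mulr_ge0 ?exprn_ge0.
have := ler_wpM2l M1 (Lb x).
have M2 := mulr_ge0 M1 (nrm_ge0 x).
have := ler_piMl M2 (ltW b1).
by rewrite exprS; lra.
Qed.

(** For [B = 1 - G / d] one has [0 <= B <= 1 - c / d < 1], so [one_minus_sqrt] yields [Y], and
    [S = 1 - Y] has square [G / d]. A Neumann series inverts [S]. *)
Lemma operator_sqrt (G : {linear V -> V}) c d : 0 < c <= d ->
  (forall x y, rip x (G y) = rip (G x) y) ->
  (forall x, c * nrm x ^+ 2 <= rip x (G x) <= d * nrm x ^+ 2) ->
  exists S Si : {linear V -> V}, [/\ bounded_op S, bounded_op Si,
    forall x, S (Si x) = x, forall x, Si (S x) = x &
    forall x, rip x (G x) = d * nrm (S x) ^+ 2].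
Proof.
move=> /andP[c0 cd] Gsym Gb; have d0 : 0 < d by apply: lt_le_trans cd.
have [B BE] : exists B : {linear V -> V}, B =1 fun x => x - d^-1%:C *: G x.
  apply: linear_of => a x y.
  by rewrite linearP scalerDr !scalerA mulrC -scalerA opprD addrACA scalerBr.
have ripB x y : rip x (B y) = rip x y - d^-1 * rip x (G y).
  by rewrite BE /rip ripBr// ripZr.
have Bsym x y : rip x (B y) = rip (B x) y.
  by rewrite ripB Gsym BE /rip ripBl// ripZl.
have b01 : 0 <= 1 - c / d < 1.
  by rewrite subr_ge0 ler_pdivrMr// mul1r cd gtrBl divr_gt0.
have [b0 b1] := andP b01.
have Bb : bounded_by (1 - c / d) B.
  apply: symmetric_bounded_by => // x; rewrite ripB {1 3}/rip (rip_nrm ip Hip).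
  have [h1 h2] := andP (Gb x).
  rewrite subr_ge0 ler_pdivrMl// h2 mulrBl mul1r lerD2l lerN2.
  by rewrite [c / d]mulrC -mulrA ler_pM2l ?invr_gt0.
have [Y [Yb Ysym Yeq]] := one_minus_sqrt B _ b01 Bsym Bb.
have [Si [Sib SiE1 SiE2]] := neumann Y _ b01 Yb.
have [S SE] : exists S : {linear V -> V}, S =1 fun x => x - Y x.
  by apply: linear_of => a x y; rewrite linearP opprD addrACA scalerBr.
exists S, Si; split=> [|||x|x].
- apply/bounded_opP; exists 2 => // x; rewrite SE.
  have := nrmD x (- Y x); rewrite nrmN; have := Yb x.
  by have := ler_wpM2r (nrm_ge0 x) (ltW b1); lra.
- by apply/bounded_opP; exists (1 - (1 - c / d))^-1 => //; rewrite invr_ge0 subr_ge0 ltW.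
- by move=> x; rewrite SE SiE1.
- by rewrite SE SiE2.
have YY : rip (Y x) (Y x) = 2 * rip x (Y x) - rip x (B x).
  have : rip x (Y x) = 2^-1 * (rip x (B x) + rip x (Y (Y x))).
    by rewrite {1}Yeq /rip ripZr// ripDr.
  by rewrite -Ysym; lra.
rewrite SE -(rip_nrm ip Hip) ripBl// !ripBr// -!/(rip _ _) YY ripB -Ysym.
by field; rewrite gt_eqF.
Qed.
End SquareRoot.

(** * Spectral radius *)

Section SpectralRadius.
Local Open Scope complex_scope.
Context {R : realType} {V : completeNormedModType R[i]}.
Implicit Types (E F : {linear V -> V}) (x y z : V) (nu : R[i]).
Implicit Types (c e p q s t K M : R).

Lemma cabsD (a b : R[i]) : cabs (a + b) <= cabs a + cabs b.
Proof. by rewrite -(@lecR R) rmorphD /= -!cabsE ler_normD. Qed.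

Lemma cabsV (a : R[i]) : cabs a^-1 = (cabs a)^-1.
Proof. by apply: (@complexI R); rewrite fmorphV /= -!cabsE normfV. Qed.

Lemma cabs_le_ReIm (u v : R) : cabs (u +i* v)%C <= `|u| + `|v|.
Proof.
rewrite [(_ +i* _)%C]complexE /=; apply: le_trans (cabsD _ _) _.
by rewrite cabsM !cabsR /cabs normc_def /= expr0n add0r expr1n sqrtr1 mul1r.
Qed.

(* With [rho_F(nu) = (1 - nu F)^-1], this says [|rho_F(nu) - rho_F(c nu)| <= e]
   for [|nu| <= t], without assuming that the resolvents exist. *)
Definition resolvent_close (f : V -> V) t c e := forall nu x y z, cabs nu <= t ->
  y - nu *: f y = x -> z - (c%:C * nu) *: f z = x -> nrm (y - z) <= e * nrm x.

(** This is the resolvent identity [rho(nu) - rho(c nu) = (1 - c) nu rho(nu) E rho(c nu)], with [M]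
    bounding both resolvents. *)
Lemma resolvent_close_base E t c e M : 0 <= c <= 1 -> 0 <= e -> 0 <= M ->
  bounded_by e E ->
  (forall nu y, cabs nu <= t -> nrm y <= M * nrm (y - nu *: E y)) ->
  resolvent_close E t c (M * (t * (1 - c) * e * M)).
Proof.
move=> /andP[c0 c1] e0 M0 Ee EM nu x y z nut Ey Ez.
have c1' : 0 <= 1 - c by rewrite subr_ge0.
have t0 : 0 <= t by apply: le_trans nut; apply: cabs_ge0.
have nut' : cabs (c%:C * nu) <= t.
  rewrite cabsM cabsR ger0_norm//; apply: le_trans nut.
  by rewrite ler_piMl ?cabs_ge0.
have hz := EM _ z nut'; rewrite Ez in hz.
have := EM _ (y - z) nut.
have -> : y - z - nu *: E (y - z) = ((1 - c)%:C * nu) *: E z.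
  rewrite linearB scalerBr opprB addrA addrAC (addrAC y) Ey -[x]Ez.
  rewrite (addrAC z) subrr add0r addrC -scalerBl.
  by congr (_ *: _); rewrite rmorphB rmorph1; ring.
move=> /le_trans; apply; rewrite -!mulrA ler_wpM2l// nrmZ cabsM cabsR ger0_norm//.
rewrite [leRHS]mulrCA -[leLHS]mulrA ler_wpM2l//.
apply: ler_pM => //; rewrite ?mulr_ge0 ?nrm_ge0 ?cabs_ge0//.
by apply: le_trans (Ee z) _; rewrite ler_wpM2l.
Qed.

(** The resolvent of [F^2] at [mu^2] is the average of those of [F] at [mu] and [- mu], so the same
    [e] survives squaring. *)
Lemma resolvent_close_sqr F t c e :
  0 <= t -> resolvent_close F t c e -> resolvent_close (F \o F) (t ^+ 2) (c ^+ 2) e.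
Proof.
move=> t0 Fce nu x y z nut /= Ey Ez.
pose mu := sqrtC nu; have mu2 : mu ^+ 2 = nu by rewrite sqrtCK.
have mut : cabs mu <= t.
  rewrite -ler_sqr ?nnegrE ?cabs_ge0//; apply: le_trans nut.
  by rewrite -mu2 !expr2 cabsM.
have factor (b : R[i]) w : w - b ^+ 2 *: F (F w) =
    (w + b *: F w) - b *: F (w + b *: F w).
  rewrite [F (w + _)]linearD [F (b *: _)]linearZ /= scalerDr scalerA -expr2.
  by rewrite opprD addrA addrK.
have factorN (b : R[i]) w : w - b ^+ 2 *: F (F w) =
    (w - b *: F w) - (- b) *: F (w - b *: F w).
  by rewrite -(sqrrN b) factor scaleNr.
have h1 := Fce mu x (y + mu *: F y) (z + (c%:C * mu) *: F z) mut.
have h2 := Fce (- mu) x (y - mu *: F y) (z - (c%:C * mu) *: F z).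
rewrite cabsN mulrN in h2.
rewrite -factor mu2 -factor exprMn mu2 -rmorphXn in h1.
rewrite -factorN mu2 -factorN exprMn mu2 -rmorphXn in h2.
have {}h1 := h1 Ey Ez; have {}h2 := h2 mut Ey Ez.
have -> : y - z = 2^-1%:C *: (((y + mu *: F y) - (z + (c%:C * mu) *: F z)) +
                  ((y - mu *: F y) - (z - (c%:C * mu) *: F z))).
  rewrite addrACA -opprD (addrACA y) subrr addr0 (addrACA z) subrr addr0.
  rewrite -!mulr2n -mulrnBl -[(y - z) *+ 2]scaler_nat scalerA.
  rewrite (_ : _ * _ = 1) ?scale1r//.
  by rewrite -(rmorph_nat (@real_complex R)) -rmorphM mulVf ?pnatr_eq0// rmorph1.
rewrite nrmZr ger0_norm ?invr_ge0//.
have := nrmD ((y + mu *: F y) - (z + (c%:C * mu) *: F z))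
             ((y - mu *: F y) - (z - (c%:C * mu) *: F z)).
by lra.
Qed.

Lemma resolvent_close_iter E t c e m : 0 <= t -> resolvent_close E t c e ->
  exists F, F =1 iter (2 ^ m) E /\
    resolvent_close F (t ^+ (2 ^ m)) (c ^+ (2 ^ m)) e.
Proof.
move=> t0 Ece; elim: m => [|m [F [FE Fce]]]; first by exists E.
exists (F \o F : {linear V -> V}); split=> [x|].
  by rewrite /= !FE -iterD addnn -mul2n -expnS.
rewrite expnSr !exprM; apply: resolvent_close_sqr => //.
by rewrite exprn_ge0.
Qed.

(** Put [x = y - s F y]. The Neumann series at [s c] gives a solution [G x] with
    [|G x - x| <= |x| / 4], and closeness gives [|y - G x| <= |x| / 4]. Hence
    [s |F y| = |x - y| <= |x| / 2], which yields [|x - y| <= |y|]. *)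
Lemma resolvent_close_step F t c s : 0 <= c -> 0 <= s <= t ->
  resolvent_close F t c 4^-1 ->
  (forall y, s * c * nrm (F y) <= 5^-1 * nrm y) ->
  forall y, s * nrm (F y) <= nrm y.
Proof.
move=> c0 /andP[s0 st] Fc sF y.
have [A AE] : exists A : {linear V -> V}, A =1 fun x => (c%:C * s%:C) *: F x.
  by apply: linear_of => a u v; rewrite linearP scalerDr !scalerA (mulrC a).
have Ab : bounded_by 5^-1 A.
  by move=> u; rewrite AE nrmZ -rmorphM cabsR ger0_norm ?mulr_ge0// (mulrC c).
have [G [_ GA _]] := neumann A 5^-1 ltac:(lra) Ab.
set x := y - s%:C *: F y; have Gx := GA x; rewrite AE in Gx.
have := Fc s%:C x y (G x); rewrite cabsR ger0_norm// => /(_ st erefl Gx) h1.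
have xe : x - y = - (s%:C *: F y) by rewrite /x addrAC subrr add0r.
have : nrm (x - y) = s * nrm (F y) by rewrite xe nrmN nrmZr ger0_norm.
have h2 : nrm (G x - x) <= 5^-1 * nrm (G x).
  have -> : G x - x = A (G x) by rewrite -[X in G x - X](GA x) opprB addrC subrK.
  exact: Ab.
have := nrm_triangle (G x) y x; have := nrmD (G x - x) x; rewrite subrK.
have := nrmD (x - y) y; rewrite subrK (nrmBC x y).
by lra.
Qed.

Lemma iter_le E e n x : 0 <= e -> bounded_by e E ->
  nrm (iter n E x) <= e ^+ n * nrm x.
Proof.
move=> e0 Ee; elim: n => [|n IH] /=; first by rewrite expr0 mul1r.
by rewrite exprS -mulrA; apply: le_trans (Ee _) _; rewrite ler_wpM2l.
Qed.

Lemma power_bound_of_iter E e p N : 0 <= e -> bounded_by e E ->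
  0 < p -> (0 < N)%N -> bounded_by (p ^+ N) (iter N E) ->
  exists2 K, 0 <= K & forall n x, nrm (iter n E x) <= K * p ^+ n * nrm x.
Proof.
(* [r] is chosen so that [e <= r p] and [r >= 1]: the powers below [N] then satisfy
   [e^n <= r^N p^n], and larger ones are reduced by [N]. *)
move=> e0 Ee p0 N0 EN; pose r := Num.max 1 (e / p).
have r1 : 1 <= r by rewrite le_max lexx.
have er : e <= r * p by rewrite -ler_pdivrMr// le_max lexx orbT.
exists (r ^+ N) => [|n]; first by rewrite exprn_ge0// (le_trans ler01).
elim/ltn_ind: n => n IH x; have [nN|Nn] := ltnP n N.
  apply: le_trans (iter_le E e n x e0 Ee) _; rewrite ler_wpM2r ?nrm_ge0//.
  apply: (@le_trans _ _ ((r * p) ^+ n)); first by rewrite lerXn2r ?nnegrE// (le_trans e0).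
  by rewrite exprMn ler_wpM2r ?exprn_ge0 ?(ltW p0)// ler_weXn2l// ltnW.
have nE : n = ((n - N) + N)%N by rewrite subnK.
rewrite [in iter n]nE iterD; apply: le_trans (IH _ _ _) _.
  by rewrite ltn_subrL N0 (leq_trans N0).
rewrite [in leRHS]nE exprD -!mulrA ler_wpM2l ?exprn_ge0 ?(le_trans ler01)//.
by rewrite ler_wpM2l ?exprn_ge0 ?(ltW p0)//; exact: EN.
Qed.

(* Gelfand's formula, by the elementary argument of Rickart: averaging over
   square roots shows that [|rho_F(nu) - rho_F(c nu)| <= e] passes from [E] to its
   powers [F = E^(2^m)] without loss, and for [c^(2^m) <= 1/5] this lets one
   descend from a small disc, where [nu F] is small, to the whole disc. *)
Lemma power_decay E e t M : 0 <= e -> bounded_by e E -> 1 < t -> 0 <= M ->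
  (forall nu y, cabs nu <= t -> nrm y <= M * nrm (y - nu *: E y)) ->
  exists K p, [/\ 0 <= K, 0 <= p < 1 &
    forall n x, nrm (iter n E x) <= K * p ^+ n * nrm x].
Proof.
move=> e0 Ee t1 M0 EM; have t0 : 0 < t by apply: lt_trans t1.
pose D := M * (t * e * M); have D0 : 0 <= D by rewrite !mulr_ge0// ltW.
(* With [c = 1 - d] this makes the constant of [resolvent_close_base] at ratio [c ^+ 2], namely
   [D (1 - c^2) <= 2 D d], at most 1/4. *)
pose d := (8 * (D + 1))^-1; have dD : D * d + d = 8^-1.
  by rewrite /d; field; rewrite gt_eqF//; lra.
have d0 : 0 < d by rewrite invr_gt0; lra.
pose c := 1 - d; have D0d : 0 <= D * d by rewrite mulr_ge0// ltW.
have c01 : 0 < c < 1 by rewrite /c; lra.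
have [c0 c1] := andP c01; have c2 : 0 <= c ^+ 2 <= 1 by rewrite expr2; nra.
(* The ratio is [c ^+ 2] because a descent step spends one factor [c ^+ N <= 5^-1] on restoring the
   constant 1/5 and gains the other as progress. *)
have Ec : resolvent_close E t (c ^+ 2) 4^-1.
  have h := resolvent_close_base E t _ e M c2 e0 M0 Ee EM.
  move=> nu x y z nut Ey Ez; apply: le_trans (h nu x y z nut Ey Ez) _.
  rewrite ler_wpM2r ?nrm_ge0//.
  have -> : M * (t * (1 - c ^+ 2) * e * M) = 2 * (D * d) - D * d * d.
    by rewrite /D /c; ring.
  by have := mulr_ge0 D0d (ltW d0); lra.
have c01' : 0 <= c < 1 by rewrite ltW.
have [m cm] := geometric_small 1 c 5^-1 c01' ltac:(lra); rewrite mul1r in cm.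
pose N := (2 ^ m)%N; have N0 : (0 < N)%N by rewrite expn_gt0.
have cN : c ^+ N <= 5^-1.
  by apply: le_trans cm; rewrite ler_wiXn2l ?(ltW c0) ?(ltW c1)// ltnW// ltn_expl.
have [F [FE Fc]] := resolvent_close_iter E t _ _ m (ltW t0) Ec.
rewrite -/N in FE Fc.
have ct0 j : 0 <= (c ^+ j * t) ^+ N by rewrite exprn_ge0// mulr_ge0 ?exprn_ge0// ltW.
have step j : (forall y, (c ^+ j.+2 * t) ^+ N * nrm (F y) <= 5^-1 * nrm y) ->
    forall y, (c ^+ j * t) ^+ N * nrm (F y) <= nrm y.
  move=> h; apply: (resolvent_close_step _ _ _ _ _ _ Fc).
  - by rewrite -exprM exprn_ge0// ltW.
  - rewrite ct0/= lerXn2r ?nnegrE ?mulr_ge0 ?exprn_ge0 ?(ltW c0) ?(ltW t0)//.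
    by rewrite ler_piMl ?(ltW t0)// exprn_ile1 ?ltW.
  - move=> y; rewrite -exprMn (_ : c ^+ j * t * c ^+ 2 = c ^+ j.+2 * t)//.
    by rewrite -(addn2 j) exprD; ring.
have descend k : (forall y, (c ^+ k.+2 * t) ^+ N * nrm (F y) <= 5^-1 * nrm y) ->
    forall y, t ^+ N * nrm (F y) <= nrm y.
  elim: k => [|k IH] h; first by move=> y; have := step 0%N h y; rewrite expr0 mul1r.
  apply: IH => y; have h1 := step k.+1 h y.
  rewrite (exprS c k.+1) -(mulrA c) exprMn -mulrA.
  apply: ler_pM => //; first by rewrite exprn_ge0// ltW.
  by rewrite mulr_ge0 ?nrm_ge0.
(* The descent starts from a disc so small that the crude bound [e] on [E] suffices. *)
have [J cJ] := geometric_small (t * e) c 5^-1 c01' ltac:(lra).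
have EN : forall y, t ^+ N * nrm (F y) <= nrm y.
  apply: (descend J) => y; rewrite FE.
  have cte : c ^+ J.+2 * t * e <= 5^-1.
    apply: le_trans cJ; rewrite -mulrA mulrC ler_wpM2l ?mulr_ge0 ?(ltW t0)//.
    by rewrite ler_wiXn2l ?(ltW c0) ?(ltW c1)// -addn2 leq_addr.
  apply: (@le_trans _ _ ((c ^+ J.+2 * t * e) ^+ N * nrm y)).
    rewrite (exprMn N (c ^+ J.+2 * t) e) -[leRHS]mulrA; apply: ler_wpM2l => //.
    exact: iter_le.
  rewrite ler_wpM2r ?nrm_ge0//; apply: le_trans (cte).
  have cte0 : 0 <= c ^+ J.+2 * t * e by rewrite mulr_ge0// mulr_ge0 ?exprn_ge0// ltW.
  apply: ler_iXnr => //; apply: le_trans cte _; lra.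
have p0 : 0 < t^-1 by rewrite invr_gt0.
have [|K K0 EK] := power_bound_of_iter E e t^-1 N e0 Ee p0 N0.
  by move=> y; rewrite exprVn ler_pdivlMl ?exprn_gt0// -FE.
exists K, t^-1; split=> //.
by rewrite invr_ge0 (ltW t0) invf_lt1.
Qed.

(** A lower bound at one point persists nearby with twice the constant, and compactness makes it
    uniform. The disc is placed in a real square, a product of compact segments; the property [P] is
    vacuous outside the disc. *)
Lemma uniform_lower_bound E e t : 0 <= e -> bounded_by e E ->
  (forall nu, cabs nu <= t ->
    exists2 K, 0 <= K & forall y, nrm y <= K * nrm (y - nu *: E y)) ->
  exists2 M, 0 <= M &
    forall nu y, cabs nu <= t -> nrm y <= M * nrm (y - nu *: E y).
Proof.
move=> e0 Ee Et.
pose cpl (u : R * R) : R[i] := (u.1 +i* u.2)%C.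
pose P (K : R) (u : R * R) := cabs (cpl u) <= t ->
  forall y, nrm y <= K * nrm (y - cpl u *: E y).
have near_disc (u : R * R) (d : R) : 0 < d ->
    nbhs u [set v | cabs (cpl v - cpl u) < d]%classic.
  move=> d0; have d20 : 0 < d / 2 by rewrite divr_gt0.
  exists (ball u.1 (d / 2), ball u.2 (d / 2)) => /=.
    by split; apply: nbhsx_ballx.
  move=> [a b] [/= ha hb]; rewrite /ball/= in ha hb.
  apply: le_lt_trans (_ : `|a - u.1| + `|b - u.2| < d).
    exact: (cabs_le_ReIm (a - u.1) (b - u.2)).
  by rewrite (distrC a) (distrC b) [d]splitr ltrD.
have cptA := compact_setX (@segment_compact R (- t) t) (@segment_compact R (- t) t).
have /compact_near_coveringP := cptA => /(_ R (+oo_R)%classic P _) [u _|M0 [_ M0P]].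
- have [ut|ut] := leP (cabs (cpl u)) t; last first.
    exists ([set v | cabs (cpl v - cpl u) < cabs (cpl u) - t], setT)%classic => /=.
      by split; [apply: near_disc; rewrite subr_gt0|exact: filterT].
    move=> [v K] [/= vu _] vt; exfalso.
    have := cabsD (cpl v) (cpl u - cpl v); rewrite addrC subrK.
    by move: vu; rewrite -cabsN opprB; lra.
  have [K0 K00 EK0] := Et _ ut.
  (* Moving the parameter by less than [d] costs at most [K0 d e |y| <= |y| / 2], which is absorbed
     on the left. *)
  pose d := (2 * (e * K0 + 1))^-1.
  have eK : 0 <= e * K0 by rewrite mulr_ge0.
  have d0 : 0 < d by rewrite invr_gt0; lra.
  have de : d * (e * K0) <= 2^-1.
    have : d * (e * K0 + 1) = 2^-1 by rewrite /d; field; rewrite gt_eqF//; lra.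
    lra.
  exists ([set v | cabs (cpl v - cpl u) < d], [set K | 2 * K0 < K])%classic => /=.
    by split; [exact: near_disc|apply: nbhs_pinfty_gt; exact: num_real].
  move=> [v K] [/= vu K0K] vt y.
  have : nrm (y - cpl u *: E y) <= nrm (y - cpl v *: E y) + d * (e * nrm y).
    have -> : y - cpl u *: E y = (y - cpl v *: E y) + (cpl v - cpl u) *: E y.
      by rewrite scalerBl addrA subrK.
    apply: le_trans (nrmD _ _) _; rewrite lerD2l nrmZ.
    by apply: ler_pM; rewrite ?cabs_ge0 ?nrm_ge0// ltW.
  move=> /(ler_wpM2l K00) /(le_trans (EK0 y)).
  have := ler_wpM2r (nrm_ge0 y) de.
  have := ler_wpM2r (nrm_ge0 (y - cpl v *: E y)) (ltW K0K).
  by lra.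
have m0 : 0 <= Num.max 0 M0 by rewrite le_max lexx.
exists (Num.max 0 M0 + 1) => [|nu y nut]; first by lra.
have M0m : M0 < Num.max 0 M0 + 1.
  by apply: (@le_lt_trans _ _ (Num.max 0 M0)); [rewrite le_max lexx orbT|lra].
have nuE : cpl (complex.Re nu, complex.Im nu) = nu by case: (nu).
have := M0P _ M0m (complex.Re nu, complex.Im nu); rewrite /P nuE; apply => //.
have leP (a : R) : a ^+ 2 <= cabs nu ^+ 2 -> `[(- t), t]%classic a.
  move=> a2; rewrite /= in_itv /= -ler_norml; apply: le_trans nut.
  by rewrite -ler_sqr ?nnegrE ?cabs_ge0// real_normK ?num_real.
have nu2 : complex.Re nu ^+ 2 + complex.Im nu ^+ 2 = cabs nu ^+ 2.
  by apply: (@complexI R); rewrite add_Re2_Im2 cabsE -rmorphXn.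
by split; apply: leP; rewrite -nu2 ?lerDl ?lerDr sqr_ge0.
Qed.

(** Boundedness of the spectrum makes the supremum in [spectral_radius] a genuine upper bound. For
    [|l| > e] the inverse of [E - l] is [- l^-1 (1 - l^-1 E)^-1]. *)
Lemma spectrum_le E e l : 0 <= e -> bounded_by e E -> spectrum E l -> cabs l <= e.
Proof.
move=> e0 Ee; rewrite leNgt => El; apply/negP => el; apply: El.
have l0 : 0 < cabs l by apply: le_lt_trans el.
have lN0 : l != 0.
  by apply/eqP => l_eq0; move: l0; rewrite l_eq0 /cabs normr0 ltxx.
have q01 : 0 <= e / cabs l < 1 by rewrite divr_ge0 ?cabs_ge0// ltr_pdivrMr ?mul1r.
have [A AE] : exists A : {linear V -> V}, A =1 fun x => l^-1 *: E x.
  by apply: linear_of => a u v; rewrite linearP scalerDr !scalerA (mulrC a).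
have Ab : bounded_by (e / cabs l) A.
  by move=> u; rewrite AE nrmZ cabsV (mulrC e) -mulrA ler_wpM2l ?invr_ge0 ?cabs_ge0.
have [G [Gb GA1 GA2]] := neumann A _ q01 Ab.
have [g gE] : exists g : {linear V -> V}, g =1 fun x => - l^-1 *: G x.
  by apply: linear_of => a u v; rewrite linearP scalerDr !scalerA (mulrC a).
have AlE x : E x - l *: x = - l *: (x - A x).
  by rewrite AE scaleNr scalerBr scalerA mulfV// scale1r opprB.
exists g; split; last split.
- apply/bounded_opP; exists (cabs (- l^-1) * (1 - e / cabs l)^-1).
    by rewrite mulr_ge0 ?cabs_ge0// invr_ge0 subr_ge0 ltW//; case/andP: q01.
  by move=> x; rewrite gE nrmZ -mulrA ler_wpM2l ?cabs_ge0.
- by move=> x; rewrite AlE gE linearZ /= -scalerBr GA1 scalerA mulrNN mulfV// scale1r.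
- by move=> x; rewrite AlE gE linearZ /= GA2 scalerA mulrNN mulVf// scale1r.
Qed.

(** For [r(E) < s < 1] and [0 < |nu| <= s^-1], the point [nu^-1] is outside the spectrum, so
    [1 - nu E] is bounded below. This holds uniformly on a disc of radius above 1, as [power_decay]
    requires. *)
Lemma spectral_radius_lt1_decay E :
  bounded_op E -> spectral_radius E < 1 ->
  exists K p, [/\ 0 <= K, 0 <= p < 1 &
    forall n x, nrm (iter n E x) <= K * p ^+ n * nrm x].
Proof.
move=> /bounded_opP[e e0 Ee] Er.
(* The maximum with 0 makes [s] positive without discussing the sign of [r]. *)
set r := spectral_radius E in Er; pose s := (1 + Num.max 0 r) / 2.
have m1 : Num.max 0 r < 1 by rewrite gt_max Er ltr01.
have m0 : 0 <= Num.max 0 r by rewrite le_max lexx.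
have mr : r <= Num.max 0 r by rewrite le_max lexx orbT.
have s0 : 0 < s by rewrite /s; lra.
have s1 : s < 1 by rewrite /s; lra.
have rs : r < s by rewrite /s; lra.
have resE l : s <= cabs l -> ~ spectrum E l.
  move=> sl El; have : cabs l <= r.
    apply: ub_le_sup; last by exists l.
    by exists e => _ [l' El' <-]; exact: spectrum_le El'.
  by lra.
have [nu nus|M M0 EM] := uniform_lower_bound E e s^-1 e0 Ee; last first.
  by apply: (power_decay E e s^-1 M) => //; rewrite invf_gt1.
have [->|nu0] := eqVneq nu 0.
  by exists 1 => // y; rewrite scale0r subr0 mul1r.
have cnu0 : 0 < cabs nu.
  rewrite lt_def cabs_ge0 andbT; apply/eqP => c0; move/eqP: nu0; apply.
  by apply: normr0_eq0; rewrite cabsE c0.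
have : ~ spectrum E nu^-1.
  by apply: resE; rewrite cabsV -[leLHS]invrK lef_pV2 ?posrE ?invr_gt0.
move=> /contrapT[g [/bounded_opP[K K0 gK] [_ gE]]].
exists (K * cabs nu^-1) => [|y]; first by rewrite mulr_ge0 ?cabs_ge0.
rewrite -{1}(gE y); apply: le_trans (gK _) _; rewrite -mulrA ler_wpM2l//.
by rewrite -nrmZ scalerBr scalerA mulVf// scale1r nrmBC.
Qed.

End SpectralRadius.

(** * Zero-product perturbations *)

Section ZeroProduct.
Local Open Scope complex_scope.
Context {R : realType} {V : completeNormedModType R[i]}.
Context (ip : V -> V -> R[i]) (Hip : is_inner_product ip).
Implicit Types (x y z : V) (K M p : R).
Let rip := rip ip.

Lemma linear_iter (E : {linear V -> V}) :
  exists Ep : nat -> {linear V -> V}, forall n, Ep n =1 iter n E.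
Proof.
have /choice[Ep EpE] : forall n, exists F : {linear V -> V}, F =1 iter n E.
  move=> n; apply: linear_of.
  by elim: n => [//|n IH] a x y; rewrite iterS IH linearP.
by exists Ep.
Qed.

(** [U n] is the sum of [Cs^k E^k] over [k < n]. Consecutive sums differ by [Cs^n E^n], which decays
    like the powers of [E] because [Cs] is a contraction. *)
Lemma stein_equation (Cs E : {linear V -> V}) K p : 0 <= p < 1 -> 0 <= K ->
  bounded_by 1 Cs ->
  (forall n x, nrm (iter n E x) <= K * p ^+ n * nrm x) ->
  exists (A : {linear V -> V}) M, [/\ 0 <= M, bounded_by M A &
    forall x, A x = x + Cs (A (E x))].
Proof.
move=> p01 K0 Cs1 EK; have [p0 p1] := andP p01.
have Cs1' x : nrm (Cs x) <= nrm x by rewrite -[leRHS]mul1r.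
have /choice[U Ueq] : forall n, exists u : {linear V -> V},
    u =1 iter n (fun g x => x + Cs (g (E x))) (fun=> 0).
  move=> n; apply: linear_of.
  elim: n => [|n IH] a x y /=; first by rewrite scaler0 addr0.
  by rewrite linearP IH linearP addrACA -scalerDr.
have U0 x : U 0%N x = 0 by exact: (Ueq 0%N).
have US n x : U n.+1 x = x + Cs (U n (E x)) by rewrite (Ueq n.+1) /= (Ueq n).
have [n x|A AU] := @linear_cvg_geometric R V U K p p01.
  apply: le_trans (EK n x); elim: n x => [|n IH] x.
    by rewrite US !U0 linear0 addr0 subr0.
  rewrite (US n.+1 x) (US n x) opprD addrACA subrr add0r -linearB iterSr.
  exact: le_trans (Cs1' _) (IH (E x)).
set M := K / (1 - p) in AU.
have M0 : 0 <= M by rewrite divr_ge0// subr_ge0 ltW.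
exists A, M; split=> // x.
  by have := AU 0%N x; rewrite U0 sub0r nrmN expr0 mulr1.
apply/eqP; rewrite -subr_eq0; apply/eqP.
apply: (@nrm_small_eq0 _ _ _ (M * nrm x + M * nrm (E x)) p) => // n.
have -> : A x - (x + Cs (A (E x))) = (A x - U n.+1 x) + Cs (U n (E x) - A (E x)).
  by rewrite US linearB /= addrA !opprD !addrA subrK.
apply: le_trans (nrmD _ _) _; rewrite (nrmBC (A x)).
have := AU n.+1 x; have := AU n (E x); have := Cs1' (U n (E x) - A (E x)).
have : p * (M * p ^+ n * nrm x) <= M * p ^+ n * nrm x.
  by rewrite ler_piMl ?(ltW p1)// mulr_ge0 ?nrm_ge0// mulr_ge0 ?exprn_ge0.
by rewrite exprS; lra.
Qed.

Lemma contraction_plus_power_decay (C E : {linear V -> V}) K p :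
  bounded_by 1 C -> 0 <= p < 1 -> 0 <= K ->
  (forall n x, nrm (iter n E x) <= K * p ^+ n * nrm x) ->
  (forall x, E (C x) = 0) ->
  exists S Si : {linear V -> V}, [/\ bounded_op S, bounded_op Si,
    forall x, S (Si x) = x, forall x, Si (S x) = x &
    forall x, nrm (S (C x + E x)) <= nrm (S x)].
Proof.
move=> C1 p01 K0 EK EC; have [p0 p1] := andP p01.
have [Cs Cs1 CsE] := adjoint_exists ip Hip C 1 ler01 C1.
have [A [M [M0 AM AE]]] := stein_equation Cs E K p p01 K0 Cs1 EK.
have [Ep EpE] := linear_iter E.
have [n Kn] := geometric_small K p 2^-1 p01 ltac:(lra).
(* [N] is positive, so the sum in [b] contains the term of [E x]. Half of [W] exceeds [M ^+ 2], the
   price of [|A E x|^2]. *)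
pose N := n.+1; pose W := 2 * (M ^+ 2 + 1).
have W0 : 0 <= W by have := sqr_ge0 M; rewrite /W; lra.
have EN x : nrm (Ep N x) <= 2^-1 * nrm x.
  rewrite EpE; apply: le_trans (EK N x) _; rewrite ler_wpM2r ?nrm_ge0//.
  apply: le_trans Kn; rewrite ler_wpM2l// exprS ler_piMl ?exprn_ge0// ltW//.
(* [b] is the polarised form of [Q]. *)
pose b x y := rip (A x) (A y) + W * \sum_(k < N) rip (Ep k.+1 x) (Ep k.+1 y).
pose D := M ^+ 2 + W * \sum_(k < N) (K * p ^+ k.+1) ^+ 2.
have D0 : 0 <= D.
  by rewrite addr_ge0 ?sqr_ge0// mulr_ge0// sumr_ge0// => k _; rewrite sqr_ge0.
have ripK (T : {linear V -> V}) q x y : bounded_by q T -> 0 <= q ->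
    `|rip (T x) (T y)| <= q ^+ 2 * (nrm x * nrm y).
  move=> Tq q0; apply: le_trans (rip_le ip Hip _ _) _.
  by rewrite expr2 mulrACA; apply: ler_pM; rewrite ?nrm_ge0.
have EpK k : bounded_by (K * p ^+ k) (Ep k) by move=> x; rewrite EpE.
have bK x y : `|b x y| <= D * nrm x * nrm y.
  rewrite -mulrA mulrDl; apply: le_trans (ler_normD _ _) _.
  rewrite lerD ?ripK// normrM ger0_norm// -mulrA ler_wpM2l//.
  apply: le_trans (ler_norm_sum _ _ _) _; rewrite mulr_suml.
  by apply: ler_sum => k _; apply: ripK => //; rewrite mulr_ge0 ?exprn_ge0.
have [x y z|r x y|x y z|a x y|//|//|G _ bG] := @form_operator R V ip Hip b D.
- rewrite /b linearD /rip ripDl// addrACA -mulrDr -big_split/=; congr (_ + _ * _).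
  by apply: eq_bigr => k _; rewrite linearD ripDl.
- rewrite /b linearZ /rip ripZl// mulrDr mulrCA [r * \sum_(_ < _) _]mulr_sumr.
  congr (_ + _ * _).
  by apply: eq_bigr => k _; rewrite linearZ ripZl.
- rewrite /b linearD /rip ripDr// addrACA -mulrDr -big_split/=; congr (_ + _ * _).
  by apply: eq_bigr => k _; rewrite linearD ripDr.
- rewrite /b !linearZ /rip ripZ//; congr (_ + _ * _).
  by apply: eq_bigr => k _; rewrite !linearZ ripZ.
have bC x y : b x y = b y x.
  congr (_ + _ * _); first exact: ripC.
  by apply: eq_bigr => k _; exact: ripC.
have bxx x : b x x = nrm (A x) ^+ 2 + W * \sum_(k < N) nrm (Ep k.+1 x) ^+ 2.
  by rewrite /b /rip rip_nrm//; under eq_bigr do rewrite rip_nrm//.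
have E1 x : Ep 1%N x = E x by rewrite EpE.
(* Since [x = A x - Cs A E x], the norm of [x] is controlled by [|A x|] and [M |E x|], both present
   in [b x x]. *)
have coer x : 2^-1 * nrm x ^+ 2 <= b x x.
  have h1 : nrm x <= nrm (A x) + M * nrm (E x).
    have := nrmD (x + Cs (A (E x))) (- Cs (A (E x))); rewrite addrK -AE nrmN.
    by have := Cs1 (A (E x)); have := AM (E x); lra.
  have h2 : nrm x ^+ 2 <= 2 * nrm (A x) ^+ 2 + 2 * (M * nrm (E x)) ^+ 2.
    apply: (@le_trans _ _ ((nrm (A x) + M * nrm (E x)) ^+ 2)).
      by rewrite lerXn2r ?nnegrE ?addr_ge0 ?mulr_ge0 ?nrm_ge0.
    by have := sqr_ge0 (nrm (A x) - M * nrm (E x)); lra.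
  have h3 : nrm (E x) ^+ 2 <= \sum_(k < N) nrm (Ep k.+1 x) ^+ 2.
    by rewrite big_ord_recl E1 lerDl sumr_ge0// => k _; rewrite sqr_ge0.
  rewrite bxx; have := ler_wpM2l W0 h3; have := sqr_ge0 (nrm (E x)).
  have -> : W * nrm (E x) ^+ 2 = 2 * (M * nrm (E x)) ^+ 2 + 2 * nrm (E x) ^+ 2.
    by rewrite /W; ring.
  by have := sqr_ge0 (M * nrm (E x)); lra.
have bdec x : b (C x + E x) (C x + E x) <= b x x.
  rewrite !bxx.
  have AT : A (C x + E x) = C x + A (E x).
    by rewrite linearD (AE (C x)) EC !linear0 addr0.
  have ET k : Ep k.+1 (C x + E x) = Ep k.+2 x.
    by rewrite !EpE !iterSr linearD EC add0r.
  have h1 : nrm (A (C x + E x)) ^+ 2 <= nrm (A x) ^+ 2 + M ^+ 2 * nrm (E x) ^+ 2.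
    (* After expansion the cross terms of [|C x + A E x|^2] and [|x + Cs A E x|^2] agree by
       adjointness. *)
    rewrite AT (nrmD_sqr ip Hip) CsE (AE x) (nrmD_sqr ip Hip).
    have : nrm (C x) ^+ 2 <= nrm x ^+ 2.
      by rewrite lerXn2r ?nnegrE ?nrm_ge0// -[leRHS]mul1r.
    have : nrm (A (E x)) ^+ 2 <= (M * nrm (E x)) ^+ 2.
      by rewrite lerXn2r ?nnegrE ?mulr_ge0 ?nrm_ge0.
    by rewrite exprMn; have := sqr_ge0 (nrm (Cs (A (E x)))); lra.
  (* Replacing [x] by [T x] shifts the sum by one: it loses [|E x|^2] and gains [|E^(N+1) x|^2], at
     most a quarter of it. *)
  have h2 : \sum_(k < N) nrm (Ep k.+1 (C x + E x)) ^+ 2 + nrm (E x) ^+ 2 =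
      \sum_(k < N) nrm (Ep k.+1 x) ^+ 2 + nrm (Ep N.+1 x) ^+ 2.
    under eq_bigr do rewrite ET.
    have : \sum_(k < N.+1) nrm (Ep k.+1 x) ^+ 2 =
      \sum_(k < N.+1) nrm (Ep k.+1 x) ^+ 2 by [].
    by rewrite [LHS]big_ord_recl [RHS]big_ord_recr E1 addrC.
  have h3 : nrm (Ep N.+1 x) ^+ 2 <= 2^-1 ^+ 2 * nrm (E x) ^+ 2.
    rewrite -exprMn lerXn2r ?nnegrE ?mulr_ge0 ?nrm_ge0//.
    by rewrite EpE iterSr -EpE.
  have h4 : W * \sum_(k < N) nrm (Ep k.+1 (C x + E x)) ^+ 2 <=
      W * (\sum_(k < N) nrm (Ep k.+1 x) ^+ 2 - 2^-1 * nrm (E x) ^+ 2).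
    by rewrite ler_wpM2l//; have := sqr_ge0 (nrm (E x)); lra.
  have -> : nrm (A x) ^+ 2 + W * (\sum_(k < N) nrm (Ep k.+1 x) ^+ 2) =
    nrm (A x) ^+ 2 + (M ^+ 2 + 1) * nrm (E x) ^+ 2 +
    W * (\sum_(k < N) nrm (Ep k.+1 x) ^+ 2 - 2^-1 * nrm (E x) ^+ 2).
    by rewrite /W; field.
  by have := sqr_ge0 (nrm (E x)); lra.
(* Adding 1/2 to the upper bound [D] makes it dominate the coercivity constant 1/2. *)
have d0 : 0 < D + 2^-1 by lra.
have [||x|S [Si [Sb Sib SSi SiS SG]]] := @operator_sqrt R V ip Hip G 2^-1 (D + 2^-1).
- by rewrite lerDr D0 andbT; lra.
- by move=> x y; rewrite -bG bC bG (ripC ip Hip).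
- rewrite -bG coer mulrDl /= bxx.
  rewrite -bxx; apply: le_trans (ler_norm _) _; apply: le_trans (bK x x) _.
  by have := sqr_ge0 (nrm x); lra.
exists S, Si; split=> // x.
rewrite -ler_sqr ?nnegrE ?nrm_ge0// -(ler_pM2l d0) -!SG -!bG.
exact: bdec.
Qed.
End ZeroProduct.

(** * Transport along the similarity of [C] *)

Theorem theorem3p2 (R : realType) (V : completeNormedModType R[i])
    (ip : V -> V -> R[i]) (Hip : is_inner_product ip)
    (C E : {linear V -> V})
    (HCb : bounded_op C) (HEb : bounded_op E)
    (HC : similar_to_contraction C)
    (HE : spectral_radius E < 1)
    (HEC : forall x : V, E (C x) = 0) :
  similar_to_contraction (C \+ E : {linear V -> V}).
Proof.
have [L [Li [/bounded_opP[l l0 Ll] /bounded_opP[m m0 Lim] LLi LiL LC]]] := HC.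
have [K [p [K0 p01 EK]]] := spectral_radius_lt1_decay E HEb HE.
have C1 : bounded_by 1 (Li \o C \o L).
  by move=> x; rewrite mul1r -(@lecR R) -!normE; exact: LC.
have E'K n x : nrm (iter n (Li \o E \o L) x) <= (m * K * l) * p ^+ n * nrm x.
  have -> : iter n (Li \o E \o L) x = Li (iter n E (L x)).
    by elim: n => [|n IH]; rewrite /= ?LiL// IH LLi.
  apply: le_trans (Lim _) _; rewrite -!mulrA ler_wpM2l//.
  apply: le_trans (EK n _) _; rewrite -!mulrA ler_wpM2l// mulrCA ler_wpM2l//.
  by case/andP: p01 => p0 _; rewrite exprn_ge0.
have E'C' x : (Li \o E \o L) ((Li \o C \o L) x) = 0.
  by rewrite /= LLi HEC linear0.
have K'0 : 0 <= m * K * l by rewrite !mulr_ge0.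
have [S [Si [Sb Sib SSi SiS ST]]] :=
  contraction_plus_power_decay ip Hip (Li \o C \o L) (Li \o E \o L) _ p
     C1 p01 K'0 E'K E'C'.
have bcomp (f g : V -> V) : bounded_op f -> bounded_op g -> bounded_op (f \o g).
  move=> /bounded_opP[r r0 fr] /bounded_opP[s s0 gs]; apply/bounded_opP.
  exists (r * s) => [|x]; first by rewrite mulr_ge0.
  by rewrite -mulrA; apply: le_trans (fr _) _; rewrite ler_wpM2l.
(* The two similarities compose: [L] turns [C] into a contraction, then [Si] turns the conjugated
   sum into one. *)
exists (L \o Si : {linear V -> V}), (S \o Li : {linear V -> V}); split.
- by apply: bcomp => //; apply/bounded_opP; exists l.
- by apply: bcomp => //; apply/bounded_opP; exists m.
- by move=> x /=; rewrite SiS LLi.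
- by move=> x /=; rewrite LiL SSi.
move=> x; rewrite !normE lecR /= -[x in leRHS]SSi linearD.
exact: ST.
Qed.
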